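(* There is no infinite order polynomially complete lattice.
   Context: The base theory is ZFC. A lattice polynomial over a lattice $L$ is a lattice term (built from variables with $\vee,\wedge$) in which some variables may be replaced by elements of $L$. For a natural number $n$, a lattice $L$ is called $n$-order polynomially complete if every monotone function $L^n\to L$ (with $L^n$ ordered coordinatewise) is induced by a lattice polynomial over $L$. $L$ is called order polynomially complete (opc) if it is $n$-order polynomially complete for every $n$. *)

(* Defs.v *)
From mathcomp Require Import all_boot all_order.
From mathcomp Require Import boolp classical_sets functions cardinality.

Set Implicit Arguments.
Unset Strict Implicit.
Unset Printing Implicit Defensive.

Inductive lattice_poly (L : Type) (n : nat) : Type :=
| LVar of 'I_n
| LConst of L
| LJoin of lattice_poly L n & lattice_poly L n
| LMeet of lattice_poly L n & lattice_poly L n.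

Fixpoint lattice_poly_eval (d : Order.disp_t) (L : latticeType d) (n : nat)
    (p : lattice_poly L n) (x : 'I_n -> L) : L :=
  match p with
  | LVar i => x i
  | LConst a => a
  | LJoin q r => Order.join (lattice_poly_eval q x) (lattice_poly_eval r x)
  | LMeet q r => Order.meet (lattice_poly_eval q x) (lattice_poly_eval r x)
  end.

(* L^n is the type 'I_n -> L; the order that [Order.nondecreasing] finds on it
   is the coordinatewise one declared in boolp (see [lefP]). *)
Definition n_order_polynomially_complete (d : Order.disp_t)
    (L : latticeType d) (n : nat) : Prop :=
  forall f : ('I_n -> L) -> L, Order.nondecreasing f ->
    exists p : lattice_poly L n, forall x, f x = lattice_poly_eval p x.

(* The case n = 0 adds no condition: a function on the one-point type
   'I_0 -> L is induced by a constant. *)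
Definition order_polynomially_complete (d : Order.disp_t)
    (L : latticeType d) : Prop :=
  forall n : nat, n_order_polynomially_complete L n.

(* Main.v *)
Require Import Defs.
From mathcomp Require Import all_boot all_order.
From mathcomp Require Import boolp classical_sets functions cardinality.
From mathcomp Require Import wochoice.

Set Implicit Arguments.
Unset Strict Implicit.
Unset Printing Implicit Defensive.

Import Order.TTheory.
Local Open Scope classical_set_scope.
Local Open Scope order_scope.

(** Suppose that [L] is infinite and order polynomially complete. The proof is
    a diagonal argument: the polynomials in [n] variables can be enumerated by
    the elements of [L] itself ([opc_enumeration], which rests on the cardinal
    identity k * k = k), so it is enough to build a monotone function that
    differs from each function of the enumeration at one point.

    - [L] has a top and a bottom element ([opc_top]). Otherwise there would be a
      monotone function exceeding [x] at every [x], whereas a polynomial [p]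
      satisfies [p x <= x `|` c], hence [p c <= c], for some constant [c].

    - Over a bounded lattice, arbitrary values on an antichain of a power of [L]
      extend to a monotone function on the whole power ([antichain_extension]).
      Diagonalizing along an antichain [a] gives [opc_antichain_fiber]: however
      [L] is distributed over the indices of [a], some fiber surjects onto [L].

    - Antichains come from polynomials. The indicator of the elements strictly
      above [x] is monotone, hence given by a unary polynomial; erase its
      constants to get its shape, of which there are countably many. Two
      polynomials of the same shape are ordered as soon as their constants are,
      but if [x < y] then the indicator for [x] is not below the one for [y]
      (compare them at [y]). Therefore the tuples made of [x] followed by the
      constants of its polynomial form an antichain as long as [x] ranges over
      elements with a given shape ([opc_shape_antichains]).

    Thus [L] is a countable union of fibers (the elements of a given shape),
    each of which embeds in an antichain of some power of [L]. If some power of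
    [L] had an infinite antichain, then by [opc_antichain_fiber], applied to the
    shapes, one fiber would surject onto [L]; this fiber provides an antichain
    indexed by [L], and [opc_antichain_fiber] applied to singleton fibers would
    make [L] a singleton. Hence antichains are finite in every power. Then each
    fiber is finite, [L] is countable, and, having no infinite antichain, it
    contains an infinite ascending or descending sequence
    ([infinite_chain_or_antichain]). A diagonal argument along that sequence
    ends the proof ([opc_countable_no_ascending], used for [L] and its dual). *)

(** * Cardinal arithmetic: an infinite type contains its square *)

Definition partial_injection (X Y : Type) (G : set (X * Y)) : Prop :=
  forall x y x' y', G (x, y) -> G (x', y') -> x = x' <-> y = y'.

Lemma partial_injection_bigcup (X Y : Type) (F : set (set (X * Y))) :
  (forall G, F G -> partial_injection G) -> total_on F subset ->
  partial_injection (\bigcup_(G in F) G).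
Proof.
move=> Finj Ftot x y x' y' [G FG Gxy] [H FH Hxy].
by case: (Ftot _ _ FG FH) => sub; [apply: (Finj H) | apply: (Finj G)] => //; exact: sub.
Qed.

(** Comparability of cardinals: a maximal partial injection is total or onto. *)
Lemma injection_total (X Y : Type) :
  (exists f : X -> Y, injective f) \/ (exists g : Y -> X, injective g).
Proof.
have [F sF Ftot|G [Ginj Gmax]] := @Zorn_bigcup _ (@partial_injection X Y).
  exact: partial_injection_bigcup Ftot.
have [Gtot|/existsNP[x0 Nx0]] := pselect (forall x, exists y, G (x, y)).
  have [f fG] := choice Gtot; left; exists f => x x' eq_f.
  exact/(Ginj _ _ _ _ (fG x) (fG x')).
have [Gtot|/existsNP[y0 Ny0]] := pselect (forall y, exists x, G (x, y)).
  have [g gG] := choice Gtot; right; exists g => y y' eq_g.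
  exact/(Ginj _ _ _ _ (gG y) (gG y')).
case: (Gmax (G `|` [set (x0, y0)])).
  split; first by left.
  by move=> /(_ (x0, y0) (or_intror erefl)) Gxy; apply: Nx0; exists y0.
move=> x y x' y' [Gxy|[-> ->]] [Gxy'|[-> ->]] //; first exact: Ginj Gxy Gxy'.
- by split=> eq; [case: Nx0; exists y; rewrite -eq|case: Ny0; exists x; rewrite -eq].
- by split=> eq; [case: Nx0; exists y'; rewrite eq|case: Ny0; exists x'; rewrite eq].
Qed.

(** The form of [injection_total] in which both sets live in one type, the
    injections being extended to total functions by the identity. *)
Lemma injection_total_set (T : Type) (A B : set T) :
  (exists f : T -> T, (forall x, A x -> B (f x)) /\
     forall x y, A x -> A y -> f x = f y -> x = y) \/
  (exists f : T -> T, (forall x, B x -> A (f x)) /\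
     forall x y, B x -> B y -> f x = f y -> x = y).
Proof.
have extend (C E : set T) (f : {x | x \in C} -> {x | x \in E}) : injective f ->
    exists f : T -> T, (forall x, C x -> E (f x)) /\
      forall x y, C x -> C y -> f x = f y -> x = y.
  move=> f_inj; exists (fun x => if insub x is Some u then val (f u) else x).
  split=> [x /mem_set Cx|x y /mem_set Cx /mem_set Cy].
    by rewrite insubT; exact/set_mem/(valP (f _)).
  by rewrite !insubT => /val_inj/f_inj[].
have [[f f_inj]|[f f_inj]] := injection_total {x | x \in A} {x | x \in B}.
- by left; exact: extend f_inj.
- by right; exact: extend f_inj.
Qed.

(** Let [G (x, y, z)] mean that the pair [(x, y)] is sent to [z]; the domain of
    such a binary operation is read off the diagonal. *)
Definition square_field (T : Type) (G : set (T * T * T)) : set T :=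
  [set x | exists z, G (x, x, z)].

(** [G] is the graph of an injection of [D * D] into [D], where [D] is its
    field. The last clause makes the empty graph admissible, as the union of the
    empty chain, while a nonempty [G] is made to extend the base graph [B]. *)
Definition partial_square (T : Type) (B G : set (T * T * T)) : Prop :=
  [/\ partial_injection G,
      forall x y z, G (x, y, z) ->
        [/\ square_field G x, square_field G y & square_field G z],
      forall x y, square_field G x -> square_field G y -> exists z, G (x, y, z)
    & G !=set0 -> B `<=` G].

Lemma partial_square_bigcup (T : Type) (B : set (T * T * T))
    (F : set (set (T * T * T))) :
  F `<=` partial_square B -> total_on F subset ->
  partial_square B (\bigcup_(G in F) G).
Proof.
move=> sF Ftot; split.
- by apply: partial_injection_bigcup => // G /sF[].
- move=> x y z [G FG Gxyz]; have [_ clG _ _] := sF _ FG.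
  have [[a ?] [b ?] [c ?]] := clG _ _ _ Gxyz.
  by split; [exists a|exists b|exists c]; exists G.
- move=> x y [z [G FG Gx]] [z' [H FH Hy]].
  have [_ _ totG _] := sF _ FG; have [_ _ totH _] := sF _ FH.
  have [sub|sub] := Ftot _ _ FG FH.
  + have [|w] := totH x y _ (ex_intro _ _ Hy); first by exists z; exact: sub.
    by exists w; exists H.
  + by have [||w] := totG x y; [exists z|exists z'; exact: sub|exists w; exists G].
- move=> [p [G FG Gp]]; have [_ _ _ sB] := sF _ FG.
  by move=> q Bq; exists G => //; apply: sB => //; exists p.
Qed.

Lemma infinite_set_sequence (T : Type) (A : set T) :
  infinite_set A -> exists i : nat -> T, injective i /\ forall n, A (i n).
Proof.
move=> /infiniteP/card_leP[f].
exists (fun n => set_val (f (SigSub (mem_set (I : [set: nat] n))))); split; last first.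
  by move=> n; apply: set_mem; apply: valP.
move=> m n /val_inj eq_f.
have /(congr1 set_val) : SigSub (mem_set (I : [set: nat] m)) =
    SigSub (mem_set (I : [set: nat] n)).
  by apply: (@inj _ _ _ f) => //; rewrite in_setE.
done.
Qed.

(** Start from a pairing function on a countable subset and take a maximal
    injection of [D * D] into [D], given by [f]. If the complement of [D] embeds
    in [D], so does the whole type, and the pairing carries over. Otherwise the
    complement contains a copy [h D] of [D], and the injection extends to
    [D] together with [h D], against maximality. *)
Lemma infinite_square (T : Type) :
  infinite_set [set: T] -> exists j : T * T -> T, injective j.
Proof.
move=> /infinite_set_sequence[i [i_inj _]].
pose B : set (T * T * T) :=
  [set p | exists m n : nat, p = (i m, i n, i (pickle (m, n)))].
have pickle_inj : injective (@pickle (nat * nat)%type).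
  exact: pcan_inj (@pickleK _).
have fieldB x : square_field B x <-> exists m, x = i m.
  split=> [[z [m [n [-> _ _]]]]|[m ->]]; first by exists m.
  by exists (i (pickle (m, m))); exists m, m.
have goodB : partial_square B B.
  split=> //.
  - move=> [x1 x2] y [x1' x2'] y' [m [n [-> -> ->]]] [m' [n' [-> -> ->]]].
    by split=> [[/i_inj -> /i_inj ->]|/i_inj/pickle_inj[-> ->]].
  - by move=> x y z [m [n [-> -> ->]]]; split; apply/fieldB; eexists.
  - move=> x y /fieldB[m ->] /fieldB[n ->].
    by exists (i (pickle (m, n))); exists m, n.
  - by move=> _ p.
have [F sF Ftot|G [[Ginj Gcl Gtot GB] Gmax]] := @Zorn_bigcup _ (partial_square B).
  exact: partial_square_bigcup.
have Gn0 : G !=set0.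
  apply: contrapT => /nonemptyPn G0; apply: (Gmax B) => //.
  rewrite G0; split; first exact: sub0set.
  by move=> /(_ (i 0, i 0, i (pickle (0, 0)))%N); apply; exists 0%N, 0%N.
have {}GB := GB Gn0.
set D := square_field G in Gcl Gtot.
have Di m : D (i m) by exists (i (pickle (m, m))); apply: GB; exists m, m.
have [f fG] : exists f : T * T -> T, forall x y, D x -> D y -> G (x, y, f (x, y)).
  suff /choice[f fG] : forall p : T * T, exists z, D p.1 -> D p.2 -> G (p, z).
    by exists f => x y; exact: (fG (x, y)).
  move=> [x y] /=; have [[Dx Dy]|NDxy] := pselect (D x /\ D y).
    by have [z Gz] := Gtot _ _ Dx Dy; exists z.
  by exists x => Dx Dy; case: NDxy.
have fD x y : D x -> D y -> D (f (x, y)).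
  by move=> Dx Dy; have [] := Gcl _ _ _ (fG _ _ Dx Dy).
have f_inj x y x' y' : D x -> D y -> D x' -> D y' ->
    f (x, y) = f (x', y') -> x = x' /\ y = y'.
  move=> Dx Dy Dx' Dy' eqf.
  by have /(_ eqf)[] := (Ginj _ _ _ _ (fG _ _ Dx Dy) (fG _ _ Dx' Dy')).2.
(* [i] provides tags in [D], by which [f] also encodes disjoint unions. *)
have [[h [hD h_inj]]|[h [hD h_inj]]] := injection_total_set D (~` D); last first.
  pose u x := if `[< D x >] then x else h x.
  have uD x : D (u x) by rewrite /u; case: asboolP => // /hD.
  pose e x := f (u x, i `[< D x >]).
  have eD x : D (e x) by exact: fD.
  have e_inj : injective e.
    move=> x y /f_inj[]//; rewrite /u => + /i_inj.
    by case: asboolP => Dx; case: asboolP => Dy //; auto.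
  by exists (fun p => f (e p.1, e p.2)) => -[x y] [x' y'] /= /f_inj[]// /e_inj-> /e_inj->.
(* [g b u] runs over [D] (for [b] false) and its copy (for [b] true). A new pair
   goes to the copy of the code of its two [D]-components and its two flags. *)
pose g (b : bool) x := if b then h x else x.
have g_inj b u c v : D u -> D v -> g b u = g c v -> b = c /\ u = v.
  case: b; case: c => //= Du Dv eq.
  - by rewrite (h_inj u v).
  - by case: (hD u Du); rewrite eq.
  - by case: (hD v Dv); rewrite -eq.
pose new (b c : bool) u v := h (f (f (u, v), i (b.*2 + c)%N)).
pose E : set (T * T * T) := [set p | exists b c u v,
  [/\ b || c, D u, D v & p = (g b u, g c v, new b c u v)]].
pose D' x := exists b u, D u /\ x = g b u.
have GE_field x : square_field (G `|` E) x <-> D' x.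
  split=> [[z [Gx|[b [c [u [v [_ Du Dv [-> _ _]]]]]]]]|[[] [u [Du ->]]]].
  - by exists false, x; split=> //; exists z.
  - by exists b, u.
  - by exists (new true true u u); right; exists true, true, u, u.
  - by have [z Gz] := Du; exists z; left.
have newD b c u v : D u -> D v -> ~ D (new b c u v) /\ D' (new b c u v).
  move=> Du Dv; have Df : D (f (f (u, v), i (b.*2 + c)%N)).
    by apply: (fD) => //; exact: fD.
  by split; [exact: hD | exists true; eexists; split; first exact: Df].
have new_inj b c u v b' c' u' v' : D u -> D v -> D u' -> D v' ->
    new b c u v = new b' c' u' v' -> [/\ b = b', c = c', u = u' & v = v'].
  move=> Du Dv Du' Dv' /h_inj/f_inj[]; try by do ?apply: (fD).
  move=> /f_inj[]// -> -> /i_inj.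
  by case: b; case: c; case: b'; case: c'.
have DD' x : D x -> D' x by exists false, x.
case: (Gmax (G `|` E)).
  split; first by left.
  move=> sub; apply: (hD _ (Di 0%N)); exists (new true true (i 0%N) (i 0%N)).
  by apply: sub; right; exists true, true, (i 0%N), (i 0%N).
split.
- move=> [x y] z [x' y'] z'.
  move=> [Gz|[b [c [u [v [bc Du Dv [-> -> ->]]]]]]]
         [Gz'|[b' [c' [u' [v' [bc' Du' Dv' [-> -> ->]]]]]]].
  + exact: Ginj Gz Gz'.
  + have [Dx Dy Dz] := Gcl _ _ _ Gz; split=> [[eqx eqy]|eqz].
      have [? _] := g_inj false x b' u' Dx Du' eqx.
      have [? _] := g_inj false y c' v' Dy Dv' eqy.
      by subst.
    by case: (newD b' c' u' v' Du' Dv').1; rewrite -eqz.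
  + have [Dx Dy Dz] := Gcl _ _ _ Gz'; split=> [[eqx eqy]|eqz].
      have [? _] := g_inj b u false x' Du Dx eqx.
      have [? _] := g_inj c v false y' Dv Dy eqy.
      by subst.
    by case: (newD b c u v Du Dv).1; rewrite eqz.
  + by split=> [[/g_inj[]// -> -> /g_inj[]// -> ->]|/new_inj[]// -> -> -> ->].
- move=> x y z [Gz|[b [c [u [v [bc Du Dv [-> -> ->]]]]]]].
    by have [? ? ?] := Gcl _ _ _ Gz; split; apply/GE_field; exact: DD'.
  split; apply/GE_field; last exact: (newD _ _ _ _ Du Dv).2.
    by exists b, u.
  by exists c, v.
- move=> x y /GE_field[b [u [Du ->]]] /GE_field[c [v [Dv ->]]].
  have [bc|] := boolP (b || c).
    by exists (new b c u v); right; exists b, c, u, v.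
  case: b; case: c => // _; have [z Gz] := Gtot u v Du Dv.
  by exists z; left.
- by move=> _ p /GB; left.
Qed.

(** * Lattice polynomials: codes, shapes, bounds and duality *)

(** A pairing [j] on [T] encodes trees with leaves in [T] as elements of [T],
    the first component of each code being the tag of the constructor. *)
Fixpoint poly_code (T : Type) (n : nat) (j : T * T -> T) (i : nat -> T)
    (p : lattice_poly T n) : T :=
  match p with
  | LVar k => j (i 0, i k)
  | LConst a => j (i 1, a)
  | LJoin q r => j (i 2, j (poly_code j i q, poly_code j i r))
  | LMeet q r => j (i 3, j (poly_code j i q, poly_code j i r))
  end%N.

Lemma poly_code_inj (T : Type) (n : nat) (j : T * T -> T) (i : nat -> T) :
  injective j -> injective i -> injective (@poly_code T n j i).
Proof.
move=> j_inj i_inj; elim=> [k|a|p IHp q IHq|p IHp q IHq]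
  [k'|a'|p' q'|p' q'] /= /j_inj[]; do ?by move=> /i_inj.
- by move=> /i_inj eqk; congr LVar; exact: val_inj.
- by move=> ->.
- by move=> /j_inj[/IHp-> /IHq->].
- by move=> /j_inj[/IHp-> /IHq->].
Qed.

(** The polynomial with its constants erased. It is again a polynomial, with [0]
    as its only constant, so that [poly_code] numbers the shapes. *)
Fixpoint poly_shape (T : Type) (n : nat) (p : lattice_poly T n) : lattice_poly nat n :=
  match p with
  | LVar k => LVar nat k
  | LConst _ => LConst n 0%N
  | LJoin q r => LJoin (poly_shape q) (poly_shape r)
  | LMeet q r => LMeet (poly_shape q) (poly_shape r)
  end.

Fixpoint poly_params (T : Type) (n : nat) (p : lattice_poly T n) : seq T :=
  match p with
  | LVar k => [::]
  | LConst a => [:: a]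
  | LJoin q r | LMeet q r => poly_params q ++ poly_params r
  end.

Lemma size_poly_params (T : Type) (n : nat) (p q : lattice_poly T n) :
  poly_shape p = poly_shape q -> size (poly_params p) = size (poly_params q).
Proof.
by elim: p q => [k|a|p IHp q IHq|p IHp q IHq] [k'|a'|p' q'|p' q'] //= [/IHp eqp /IHq eqq];
  rewrite !size_cat eqp eqq.
Qed.

(** Beyond the end of the sequences, both sides are the default [c]. *)
Lemma nth_le_cat (d : Order.disp_t) (T : porderType d) (c : T) (s s' t t' : seq T) :
  size s = size s' ->
  (forall i, nth c (s ++ t) i <= nth c (s' ++ t') i) ->
  (forall i, nth c s i <= nth c s' i) /\ (forall i, nth c t i <= nth c t' i).
Proof.
move=> eq_sz le_st; split=> i.
  have [lt_is|le_si] := ltnP i (size s); last by rewrite !nth_default -?eq_sz.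
  by have := le_st i; rewrite !nth_cat -eq_sz lt_is.
by have := le_st (size s + i)%N; rewrite !nth_cat -eq_sz ltnNge leq_addr/= addKn.
Qed.

(** A polynomial is monotone in its constants. *)
Lemma poly_eval_le_params (d : Order.disp_t) (L : latticeType d) (n : nat) (c : L)
    (p q : lattice_poly L n) (x : 'I_n -> L) :
  poly_shape p = poly_shape q ->
  (forall i, nth c (poly_params p) i <= nth c (poly_params q) i) ->
  lattice_poly_eval p x <= lattice_poly_eval q x.
Proof.
elim: p q => [k|a|p IHp q IHq|p IHp q IHq] [k'|a'|p' q'|p' q'] //=.
- by move=> [->].
- by move=> _ /(_ 0%N).
- move=> [sp sq] /nth_le_cat[|lp lq]; first exact: size_poly_params.
  by rewrite leU2 ?IHp ?IHq.
- move=> [sp sq] /nth_le_cat[|lp lq]; first exact: size_poly_params.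
  by rewrite leI2 ?IHp ?IHq.
Qed.

Fixpoint poly_dual (T : Type) (n : nat) (p : lattice_poly T n) : lattice_poly T n :=
  match p with
  | LVar k => LVar T k
  | LConst a => LConst n a
  | LJoin q r => LMeet (poly_dual q) (poly_dual r)
  | LMeet q r => LJoin (poly_dual q) (poly_dual r)
  end.

Lemma opc_dual (d : Order.disp_t) (L : latticeType d) :
  order_polynomially_complete L -> order_polynomially_complete (L^d)%type.
Proof.
move=> opc n f f_mono; have [|p pE] := opc n (f : ('I_n -> L) -> L).
  move=> x y /lefP le_xy; have := f_mono y x; rewrite leEdual; apply.
  by apply/lefP => i; rewrite leEdual.
exists (poly_dual p) => x; rewrite pE.
by elim: p {pE} => //= q -> r ->.
Qed.

Lemma opc_unary (d : Order.disp_t) (L : latticeType d) (g : L -> L) :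
  order_polynomially_complete L -> {homo g : x y / x <= y} ->
  exists p : lattice_poly L 1, forall x, g x = lattice_poly_eval p (fun=> x).
Proof.
move=> opc g_mono; have [|p pE] := opc 1%N (fun v => g (v ord0)).
  by move=> v w /lefP le_vw; exact/g_mono/le_vw.
by exists p => x; rewrite -pE.
Qed.

(** The join of all the constants is a suitable [c]; [c0] serves for a
    polynomial without constants. *)
Lemma poly_eval_le_join (d : Order.disp_t) (L : latticeType d) (n : nat)
    (p : lattice_poly L n) (c0 : L) :
  exists c, forall x, lattice_poly_eval p (fun=> x) <= x `|` c.
Proof.
elim: p => [k|a|p [a IHp] q [b IHq]|p [a IHp] q _] /=.
- by exists c0 => x; exact: leUl.
- by exists a => x; exact: leUr.
- exists (a `|` b) => x; rewrite leUx (le_trans (IHp x)) ?(le_trans (IHq x))//.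
    by rewrite leU2 ?leUr.
  by rewrite leU2 ?leUl.
- by exists a => x; exact: le_trans (leIl _ _) (IHp x).
Qed.

(** Well-order [L] and, if there is no top, let [m x] be the least element that is
    not below [x]. Then [x `|` m x] is monotone in [x]: for [x <= y], either
    [m x <= y], or [m x] is also the least element not below [y]. It exceeds
    [x] everywhere, which [poly_eval_le_join] forbids at [x = c]. *)
Lemma opc_top (d : Order.disp_t) (L : latticeType d) (c0 : L) :
  order_polynomially_complete L -> exists t : L, forall x, x <= t.
Proof.
move=> opc; apply: contrapT => Ntop.
have [R Rwo] := well_ordering_principle L.
have /choice[m mP] : forall x : L, exists y,
    ~~ (y <= x) /\ forall z, ~~ (z <= x) -> R y z.
  move=> x; have [|y [[yx ymin] _]] := Rwo [pred y | ~~ (y <= x)].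
    apply: contrapT => Nx; apply: Ntop; exists x => y.
    by apply: contrapT => /negP Nyx; apply: Nx; exists y.
  by exists y; split=> // z; exact: ymin.
have Ranti y z : R y z -> R z y -> y = z.
  move=> Ryz Rzy; have [|w [_ wuniq]] := Rwo (pred2 y z).
    by exists y; rewrite inE eqxx.
  have Rrefl v : R v v.
    have [|u [[/eqP uv umin] _]] := Rwo (pred1 v); first by exists v; rewrite inE.
    by have := umin v; rewrite uv; apply; rewrite inE.
  rewrite -(wuniq y) ?(wuniq z)//.
    by split; [rewrite !inE eqxx orbT|move=> v /pred2P[]->].
  by split; [rewrite !inE eqxx|move=> v /pred2P[]->].
have [|p pE] := @opc_unary _ _ (fun x => x `|` m x) opc.
  move=> x y le_xy; rewrite leUx (le_trans le_xy) ?leUl//=.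
  have [le_my|Nle_my] := boolP (m x <= y); first by rewrite (le_trans le_my) ?leUl.
  have [Nmy ymin] := mP y; have [_ xmin] := mP x.
  rewrite (@Ranti (m x) (m y)) ?leUr ?ymin// xmin//.
  by apply: contra Nmy => le_mx; exact: le_trans le_xy.
have [c cP] := poly_eval_le_join p c0.
have [/negP[]] := mP c; have := cP c; rewrite -pE joinxx.
by apply: le_trans; exact: leUr.
Qed.

(** * Enumerating the monotone functions and diagonalizing along an antichain *)

(** By completeness the monotone functions are the polynomials, which inject in
    [L] by [poly_code]; [e] inverts this injection. *)
Lemma opc_enumeration (d : Order.disp_t) (L : latticeType d) (n : nat) :
  infinite_set [set: L] -> order_polynomially_complete L ->
  exists e : L -> ('I_n -> L) -> L,
    forall f : ('I_n -> L) -> L, Order.nondecreasing f -> exists z, e z = f.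
Proof.
move=> Linf opc; have [j j_inj] := infinite_square Linf.
have [i [i_inj _]] := infinite_set_sequence Linf.
have /choice[e eE] : forall z : L, exists f : ('I_n -> L) -> L,
    forall p, poly_code j i p = z -> lattice_poly_eval p = f.
  move=> z; have [[p pz]|Nz] :=
      pselect (exists p : lattice_poly L n, poly_code j i p = z).
    exists (lattice_poly_eval p) => q.
    by rewrite -pz => /(poly_code_inj j_inj i_inj)->.
  by exists (fun=> z) => p pz; case: Nz; exists p.
exists e => f /opc[p pE]; exists (poly_code j i p).
by rewrite -(eE _ p erefl); apply/funext => x; rewrite pE.
Qed.

(** [f y] is [v i] if [a i] is the only member of the antichain below [y]; it is
    the bottom [b] if there is none, and the top [t] if there are several. *)
Lemma antichain_extension (d : Order.disp_t) (L : latticeType d) (t b : L)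
    (d' : Order.disp_t) (T : porderType d') (I : Type) (a : I -> T) (v : I -> L) :
  (forall x, x <= t) -> (forall x, b <= x) ->
  (forall i j, a i <= a j -> i = j) ->
  exists f : T -> L, {homo f : x y / x <= y} /\ forall i, f (a i) = v i.
Proof.
move=> tP bP a_anti.
have /choice[f fP] : forall y : T, exists z : L,
    [/\ forall i j, a i <= y -> a j <= y -> i <> j -> z = t,
        forall i, a i <= y -> (forall j, a j <= y -> j = i) -> z = v i
      & (forall i, ~ a i <= y) -> z = b].
  move=> y; have [[i [j [iy jy ij]]]|one] :=
      pselect (exists i j, [/\ a i <= y, a j <= y & i <> j]).
    exists t; split=> // [k ky ku|/(_ i)//].
    by case: ij; rewrite (ku i iy) (ku j jy).
  have [[i iy]|none] := pselect (exists i, a i <= y).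
    exists (v i); split=> [j k jy ky jk|j jy ju|/(_ i)//].
      by case: one; exists j, k.
    by rewrite (ju i iy).
  by exists b; split=> // [i j iy|i iy]; case: none; exists i.
exists f; split=> [x y le_xy|i]; last first.
  by have [_ fv _] := fP (a i); apply: fv => // j /a_anti.
have [_ fx1 fx0] := fP x; have [fy2 fy1 _] := fP y.
have [[i ix]|none] := pselect (exists i, a i <= x); last first.
  by rewrite fx0// => i ix; apply: none; exists i.
have iy := le_trans ix le_xy.
have [[j [jy ij]]|uniqy] := pselect (exists j, a j <= y /\ i <> j).
  by rewrite (fy2 i j).
have {}uniqy j : a j <= y -> j = i.
  by move=> jy; apply: contrapT => ij; apply: uniqy; exists j; split=> // /esym.
rewrite (fx1 i ix) ?(fy1 i iy)// => j jx; apply: uniqy; exact: le_trans le_xy.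
Qed.

(** If no fiber of [phi] surjected onto [L], then for each [i] one could choose a
    value [v i] that the functions enumerated by the fiber of [i] avoid at
    [a i]. A monotone function with these values on the antichain would then be
    missing from the enumeration. *)
Lemma opc_antichain_fiber (d : Order.disp_t) (L : latticeType d) (t b : L)
    (n : nat) (I : Type) (a : I -> 'I_n -> L) (phi : L -> I) :
  infinite_set [set: L] -> order_polynomially_complete L ->
  (forall x, x <= t) -> (forall x, b <= x) ->
  (forall i j, a i <= a j -> i = j) ->
  exists i (s : L -> L), forall y, exists2 x, phi x = i & s x = y.
Proof.
move=> Linf opc tP bP a_anti; have [e eP] := opc_enumeration n Linf opc.
apply: contrapT => Nsurj.
have /choice[v vP] : forall i, exists y, forall z, phi z = i -> e z (a i) <> y.
  move=> i; apply: contrapT => Ny; apply: Nsurj; exists i, (fun z => e z (a i)) => y.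
  apply: contrapT => Nz; apply: Ny; exists y => z zi ez.
  by apply: Nz; exists z.
have [f [f_mono fa]] := antichain_extension v tP bP a_anti.
have [z ez] := eP f f_mono.
by have := vP _ z erefl; rewrite ez fa.
Qed.

(** * Antichains made of the constants of polynomials *)

(** [phi x] is the number of the shape of a polynomial [p x] representing the
    indicator of the elements strictly above [x], and [a x] lists [x] and the
    constants of [p x]. If [a x <= a y] with equal shapes, then [p x] is
    pointwise below [p y]; when [x < y] this fails at [y], where [p x] takes the
    value [t] and [p y] the value [b]. *)
Lemma opc_shape_antichains (d : Order.disp_t) (L : latticeType d) (t b : L) :
  order_polynomially_complete L ->
  ~~ (t <= b) -> (forall x, x <= t) -> (forall x, b <= x) ->
  exists phi : L -> nat, forall s, exists K (a : L -> 'I_K -> L),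
    forall x y, phi x = s -> phi y = s -> a x <= a y -> x = y.
Proof.
move=> opc Ntb tP bP.
have /choice[p pE] : forall x : L, exists p : lattice_poly L 1,
    forall y, (if x < y then t else b) = lattice_poly_eval p (fun=> y).
  move=> x; apply: opc_unary => // y z le_yz.
  by case: ifP => // lt_xy; rewrite (lt_le_trans lt_xy le_yz).
pose phi x := poly_code pickle id (poly_shape (p x)).
have phi_inj x y : phi x = phi y -> poly_shape (p x) = poly_shape (p y).
  by apply: poly_code_inj => //; exact: pcan_inj (@pickleK _).
exists phi => s; have [[x0 <-]|Ns] := pselect (exists x, phi x = s); last first.
  by exists 0%N, (fun _ _ => t) => x y xs; case: Ns; exists x.
exists (size (poly_params (p x0))).+1, (fun x i => nth t (x :: poly_params (p x)) i).
move=> x y /phi_inj phix /phi_inj phiy /lefP le_xy.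
have {}le_xy i : nth t (x :: poly_params (p x)) i <= nth t (y :: poly_params (p y)) i.
  have [lti|lei] := ltnP i (size (poly_params (p x0))).+1.
    exact: (le_xy (Ordinal lti)).
  by rewrite !nth_default//= ?(size_poly_params phix) ?(size_poly_params phiy).
apply/eqP; apply: contraNT Ntb => neq_xy.
have lt_xy : x < y by rewrite lt_neqAle neq_xy (le_xy 0%N).
have := @poly_eval_le_params _ _ _ t (p x) (p y) (fun=> y).
rewrite -!pE lt_xy ltxx; apply; first by rewrite phix.
by move=> i; exact: (le_xy i.+1).
Qed.

(** * The countable case *)

Lemma dependent_sequence (T : Type) (P : T -> Prop) (R : T -> T -> Prop) (x0 : T) :
  P x0 -> (forall x, P x -> exists y, P y /\ R x y) ->
  exists a : nat -> T, forall n, R (a n) (a n.+1).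
Proof.
move=> Px0 step.
have /choice[s sP] : forall x, exists y, P x -> P y /\ R x y.
  move=> x; have [/step[y yP]|NPx] := pselect (P x); first by exists y.
  by exists x.
have Pa n : P (iter n s x0) by elim: n => //= n /sP[].
by exists (fun n => iter n s x0) => n; have [] := sP _ (Pa n).
Qed.

(** If every element with infinitely many elements below has a smaller one of
    the same kind, one descends for ever. Otherwise take [x] with infinitely many
    elements below, while each smaller element has finitely many. If the
    elements covered by [x] do not dominate all those smaller than [x], one ascends
    for ever below [x]; if they do, they are infinite in number, and they form
    an antichain. *)
Lemma infinite_chain_or_antichain (d : Order.disp_t) (T : porderType d) (t : T) :
  infinite_set [set: T] -> (forall x, x <= t) ->
  exists a : nat -> T, [\/ forall n, a n < a n.+1, forall n, a n.+1 < a n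
                         | forall i j, a i <= a j -> i = j].
Proof.
move=> Tinf tP; pose down (x : T) := [set y | y <= x].
have [[x [xinf xmin]]|Nmin] := pselect (exists x, infinite_set (down x) /\
    forall y, y < x -> finite_set (down y)); last first.
  have [|x xinf|a aP] := @dependent_sequence T
      (fun x => infinite_set (down x)) (fun x y => y < x) t.
  - by apply: sub_infinite_set Tinf => x _; exact: tP.
  - apply: contrapT => Nx; apply: Nmin; exists x; split=> // y lt_yx.
    by apply: contrapT => yinf; apply: Nx; exists y.
  - by exists a; apply: Or32.
pose M := [set m | m < x /\ forall z, m < z -> ~ z < x].
have [[y [lt_yx yM]]|cover] := pselect (exists y, y < x /\ forall m, M m -> ~ y <= m).
  have [//|z [le_yz lt_zx]|a aP] :=
    @dependent_sequence T (fun z => y <= z /\ z < x) (fun z w => z < w) y.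
  - apply: contrapT => Nz; apply: (yM z) => //; split=> // w lt_zw lt_wx.
    by apply: Nz; exists w; split=> //; split=> //; exact: le_trans le_yz (ltW lt_zw).
  - by exists a; apply: Or31.
have /infinite_set_sequence[a [a_inj aM]] : infinite_set M.
  move=> Mfin; apply: xinf.
  apply: (@sub_finite_set _ _ ([set x] `|` \bigcup_(m in M) down m)).
    move=> y; rewrite /down/= le_eqVlt => /predU1P[->|lt_yx]; [by left|right].
    apply: contrapT => Ny; apply: cover; exists y; split=> // m Mm le_ym.
    by apply: Ny; exists m.
  rewrite finite_setU; split; first exact: finite_set1.
  by apply: bigcup_finite => // m [/xmin].
exists a; apply: Or33 => i j; rewrite le_eqVlt => /predU1P[/a_inj//|lt_ij].
by have [_ /(_ _ lt_ij)] := aM i; have [] := aM j.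
Qed.

(** Along an ascending sequence [a], with [c] numbering [L], choose [g n] among
    [2n] and [2n+1] so that the function enumerated by the element of number [n]
    does not take the value [a (g n)] at [a n]. As [g] is increasing, the
    prescription sending [a n] to [a (g n)] extends to a monotone function,
    which is absent from the enumeration. *)
Lemma opc_countable_no_ascending (d : Order.disp_t) (L : latticeType d) (t : L)
    (c : L -> nat) (a : nat -> L) :
  infinite_set [set: L] -> order_polynomially_complete L ->
  (forall x, x <= t) -> injective c -> ~ forall n, a n < a n.+1.
Proof.
move=> Linf opc tP c_inj a_lt; have [e eP] := opc_enumeration 1 Linf opc.
have ale : {mono a : m n / (m <= n)%N >-> m <= n}.
  apply: le_mono; apply: homo_ltn a_lt => //; exact: lt_trans.
have /choice[g gP] : forall n, exists m, (n.*2 <= m <= n.*2.+1)%N /\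
    forall z, c z = n -> e z (fun=> a n) <> a m.
  move=> n; have [[z [<- ez]]|N] :=
      pselect (exists z, c z = n /\ e z (fun=> a n) = a n.*2); last first.
    exists n.*2; rewrite leqnn leqnSn; split=> // z zn ez.
    by apply: N; exists z.
  exists (c z).*2.+1; rewrite leqnSn leqnn; split=> // z' /c_inj->.
  by rewrite ez => eq_a; have := a_lt (c z).*2; rewrite -eq_a ltxx.
have g_mono m n : (m <= n)%N -> a (g m) <= a (g n).
  rewrite ale leq_eqVlt => /predU1P[->//|lt_mn].
  have [/andP[_ gm] _] := gP m; have [/andP[gn _] _] := gP n.
  by apply: leq_trans gm (leq_trans _ gn); rewrite ltn_double.
(* The value at [x] depends on the least [n] such that [a n] is not below [x]. For
   [x = a k] this is [k + 1], hence the predecessor, which sends [n = 0] to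
   the harmless value [a (g 0)]; the least [n] grows with [x], and the top is the
   value where there is no such [n]. *)
have /choice[h hP] : forall x : L, exists y,
    (exists n, [/\ ~~ (a n <= x), forall m, (m < n)%N -> a m <= x & y = a (g n.-1)]) \/
    ((forall n, a n <= x) /\ y = t).
  move=> x; have [all|] := pselect (forall n, a n <= x); first by exists t; right.
  move=> /existsNP[n0 /negP Nn0].
  have ex : exists n, ~~ (a n <= x) by exists n0.
  case: (ex_minnP ex) => n Nn nmin; exists (a (g n.-1)); left; exists n.
  split=> // m lt_mn.
  by apply: contraTT lt_mn => /nmin; rewrite -leqNgt.
have h_mono : {homo h : x y / x <= y}.
  move=> x y le_xy; case: (hP y) => [[n [Nn nmin ->]]|[_ ->]]; last exact: tP.
  have Nnx : ~~ (a n <= x) by apply: contra Nn => le_nx; exact: le_trans le_xy.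
  case: (hP x) => [[m [Nm mmin ->]]|[all _]]; last by rewrite all in Nnx.
  apply: g_mono; rewrite -!subn1 leq_sub2r// leqNgt.
  by apply: contra Nnx => /mmin.
have ha n : h (a n) = a (g n).
  case: (hP (a n)) => [[m [Nm mmin ->]]|[all _]]; last first.
    by have := all n.+1; rewrite ale ltnn.
  rewrite ale -ltnNge in Nm; suff -> : m = n.+1 by [].
  apply/eqP; rewrite eqn_leq Nm andbT leqNgt; apply/negP => /mmin.
  by rewrite ale ltnn.
have [|z ez] := eP (fun v => h (v ord0)).
  by move=> v w /lefP le_vw; exact/h_mono/le_vw.
by have [_ /(_ z erefl)] := gP (c z); rewrite ez ha.
Qed.

(** * The theorem *)

Theorem mainTheorem2 (d : Order.disp_t) (L : latticeType d) :
  infinite_set [set: L] -> ~ order_polynomially_complete L.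
Proof.
move=> Linf opc; have [c0 _] := infinite_setN0 Linf.
have opcd := opc_dual opc.
have [t tP] := opc_top c0 opc.
have [b bP] : exists b : L, forall x, b <= x := @opc_top _ (L^d)%type c0 opcd.
have Ntb : ~~ (t <= b).
  apply/negP => le_tb; apply: Linf; apply: sub_finite_set (finite_set1 b) => x _ /=.
  by apply/le_anti; rewrite (le_trans (tP x) le_tb); exact: bP.
have [phi phiP] := opc_shape_antichains opc Ntb tP bP.
have no_antichain n (a : nat -> 'I_n -> L) : ~ forall i j, a i <= a j -> i = j.
  move=> /(opc_antichain_fiber phi Linf opc tP bP)[s [f fsurj]].
  have /choice[r rP] : forall y, exists x, phi x = s /\ f x = y.
    by move=> y; have [x] := fsurj y; exists x.
  have [K [u uP]] := phiP s.
  have r_inj : injective r by apply: (can_inj (g := f)) => y; have [] := rP y.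
  have [|x [g gsurj]] := @opc_antichain_fiber _ L t b _ L (u \o r) id Linf opc tP bP.
    by move=> x y /uP eq_r; apply: r_inj; apply: eq_r; have [] := rP x; have [] := rP y.
  case/negP: Ntb.
  have [y -> gt] := gsurj t; have [y' -> gb] := gsurj b.
  by rewrite -gt -gb.
have phi_fin s : finite_set [set x | phi x = s].
  apply: contrapT => /infinite_set_sequence[r [r_inj rs]]; have [K [u uP]] := phiP s.
  apply: (@no_antichain _ (u \o r)) => i j /uP eq_r.
  by apply: r_inj; apply: eq_r; exact: rs.
have /countable_injP[c c_inj] : countable [set: L].
  have -> : [set: L] = \bigcup_(s in [set: nat]) [set x | phi x = s].
    by apply/seteqP; split=> // x _; exists (phi x).
  by apply: bigcup_countable => // s _; exact/finite_set_countable/phi_fin.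
have {}c_inj : injective c by move=> x y; apply: c_inj; rewrite in_setE.
have [a [a_lt|a_gt|a_anti]] := infinite_chain_or_antichain Linf tP.
- exact: (opc_countable_no_ascending Linf opc tP c_inj a_lt).
- exact: (@opc_countable_no_ascending _ (L^d)%type _ _ a Linf opcd bP c_inj a_gt).
- apply: (@no_antichain 1%N (fun i _ => a i)) => i j /lefP/(_ ord0).
  exact: a_anti.
Qed.
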